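(* Let $\mu=\frac13$ and let $\Phi=\{\varphi_i\}_{i\in[6]}$ be any sequence of $6$ unit vectors in $\mathbb{R}^4$ (a $6$-packing in $\mathbb{R}\mathbf{P}^3$) whose Gram matrix is \[ \Phi^\top\Phi= \begin{bmatrix} 1&\mu&\mu&-\mu&-\mu&\mu\\ \mu&1&-\mu&-\mu&\mu&\mu\\ \mu&-\mu&1&-\mu&\mu&\mu\\ -\mu&-\mu&-\mu&1&-\mu&\mu\\ -\mu&\mu&\mu&-\mu&1&\mu\\ \mu&\mu&\mu&\mu&\mu&1 \end{bmatrix}. \] Then $\Phi$ is an optimal $6$-packing in $\mathbb{R}\mathbf{P}^3$.
   Context: Write $[n]=\{1,\dots,n\}$. An $n$-packing in $\mathbb{R}\mathbf{P}^{d-1}$ is a sequence $\Phi=\{\varphi_i\}_{i\in[n]}$ of $n$ unit vectors in $\mathbb{R}^d$; $\Phi$ also denotes the $d\times n$ matrix whose $i$th column is $\varphi_i$. Its coherence is $\mu(\Phi)=\max_{i\neq j}|\langle\varphi_i,\varphi_j\rangle|$. An $n$-packing $\Phi$ in $\mathbb{R}\mathbf{P}^{d-1}$ is optimal if $\mu(\Phi)\le\mu(\Psi)$ for every $n$-packing $\Psi$ in $\mathbb{R}\mathbf{P}^{d-1}$. *)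

(* Defs.v *)
From HB Require Import structures.
From mathcomp Require Import all_boot all_order all_algebra.
From mathcomp Require Import reals.
Set Implicit Arguments.
Unset Strict Implicit.
Unset Printing Implicit Defensive.
Import Order.TTheory GRing.Theory Num.Theory.
Local Open Scope ring_scope.

Definition inner (R : realType) (d : nat) (u v : 'cV[R]_d) : R :=
  \sum_(k < d) u k 0 * v k 0.

(* A sequence of n vectors in R^d is identified with the d x n matrix whose
   columns are those vectors. *)
Definition is_packing (R : realType) (d n : nat) (Phi : 'M[R]_(d, n)) : Prop :=
  forall i : 'I_n, Num.sqrt (inner (col i Phi) (col i Phi)) = 1.

(* The default value 0 is harmless: all terms are nonnegative, so it only
   matters for n <= 1, when the maximum is over the empty set. *)
Definition coherence (R : realType) (d n : nat) (Phi : 'M[R]_(d, n)) : R :=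
  \big[Num.max/0]_(p : 'I_n * 'I_n | p.1 != p.2)
    `|inner (col p.1 Phi) (col p.2 Phi)|.

Definition is_optimal_packing (R : realType) (d n : nat)
    (Phi : 'M[R]_(d, n)) : Prop :=
  is_packing Phi /\
  forall Psi : 'M[R]_(d, n), is_packing Psi -> coherence Phi <= coherence Psi.

Definition gram6 (R : realType) (mu : R) : 'M[R]_6 :=
  \matrix_(i < 6, j < 6)
    (nth [::]
      [:: [::    1;   mu;   mu; - mu; - mu;   mu];
          [::   mu;    1; - mu; - mu;   mu;   mu];
          [::   mu; - mu;    1; - mu;   mu;   mu];
          [:: - mu; - mu; - mu;    1; - mu;   mu];
          [:: - mu;   mu;   mu; - mu;    1;   mu];
          [::   mu;   mu;   mu;   mu;   mu;    1]] i)`_j.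

(* Main.v *)
Require Import Defs.
From HB Require Import structures.
From mathcomp Require Import all_boot all_order all_algebra.
From mathcomp Require Import ring lra.
From mathcomp Require Import reals.
Set Implicit Arguments.
Unset Strict Implicit.
Unset Printing Implicit Defensive.
Import Order.TTheory GRing.Theory Num.Theory.
Local Open Scope ring_scope.

(** The packing has coherence 1/3, so it must be shown that six unit vectors of
    R^4 never have coherence m < 1/3.  Their Gram matrix G has rank at most 4,
    hence its kernel contains two orthonormal vectors u and v.  Let
    P = u u^T + v v^T be the projection onto their span.  Then
    tr (G P) = 0, and as G has a unit diagonal and tr P = 2, the off-diagonal
    part of this trace equals -2; therefore
    2 <= m (sum_(i, j) |P_ij| - 2).  It remains to see that
    sum_(i, j) |P_ij| <= 8.

    This last estimate is the case n = 6 of [sum_abs_projection_le], which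
    bounds the entrywise l1 norm of a rank two projection of R^n by 4n/3.
    Write (u_i, v_i) = w_i (cos t_i, sin t_i) with w_i >= 0, so that
    P_ij = w_i w_j cos (t_i - t_j).  The inequality
    |cos t| <= 2/3 + 7/18 cos 2t - 1/18 cos 4t is sharp at t = 0 and
    t = pi/3, the angles that occur for three equiangular lines of the plane.
    After multiplication by w_i w_j and summation, the cos 4t term is minus a
    sum of squares and can be dropped, the constant gives 2/3 s^2 with
    s = sum_i w_i, and the cos 2t term gives 7/18 |sum_i z_i|^2 with
    z_i = w_i exp (2 i t_i).  Orthonormality of u and v says that
    sum_i w_i z_i = 0, so z_i may be weighted by the component 1 - (s/2) w_i
    of the all-ones vector orthogonal to w; Cauchy-Schwarz
    then yields |sum_i z_i|^2 <= 2n - s^2.  Since 2/3 >= 7/18, the resulting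
    bound 2/3 s^2 + 7/18 (2n - s^2) increases with s^2, and s^2 <= 2n. *)

(** * The planar inequality *)

(** With (c, s) = (cos t, sin t), this is
    cos (2 t1 - 2 t2) = 2 cos (t1 - t2)^2 - 1. *)
Lemma double_angle_dot (R : comNzRingType) (c1 s1 c2 s2 : R) :
    c1 ^+ 2 + s1 ^+ 2 = 1 -> c2 ^+ 2 + s2 ^+ 2 = 1 ->
  (c1 ^+ 2 - s1 ^+ 2) * (c2 ^+ 2 - s2 ^+ 2) + (2 * c1 * s1) * (2 * c2 * s2) =
  2 * (c1 * c2 + s1 * s2) ^+ 2 - 1.
Proof.
move=> h1 h2.
transitivity (2 * (c1 * c2 + s1 * s2) ^+ 2
              - (c1 ^+ 2 + s1 ^+ 2) * (c2 ^+ 2 + s2 ^+ 2)); first by ring.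
by rewrite h1 h2 mulr1.
Qed.

Lemma double_angle_unit (R : comNzRingType) (c s : R) :
  c ^+ 2 + s ^+ 2 = 1 -> (c ^+ 2 - s ^+ 2) ^+ 2 + (2 * c * s) ^+ 2 = 1.
Proof.
move=> h; transitivity ((c ^+ 2 + s ^+ 2) ^+ 2); first by ring.
by rewrite h expr1n.
Qed.

(** The bound |cos t| <= 2/3 + 7/18 cos 2t - 1/18 cos 4t: in terms of
    x = |cos t|, nine times the difference is (1 - x) (2x - 1)^2 (x + 2). *)
Lemma abs_dot_le (R : realFieldType) (c1 s1 c2 s2 : R) :
    c1 ^+ 2 + s1 ^+ 2 = 1 -> c2 ^+ 2 + s2 ^+ 2 = 1 ->
  let C1 := c1 ^+ 2 - s1 ^+ 2 in let S1 := 2 * c1 * s1 in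
  let C2 := c2 ^+ 2 - s2 ^+ 2 in let S2 := 2 * c2 * s2 in
  `|c1 * c2 + s1 * s2| <=
    2 / 3 + 7 / 18 * (C1 * C2 + S1 * S2)
    - 1 / 18 * ((C1 ^+ 2 - S1 ^+ 2) * (C2 ^+ 2 - S2 ^+ 2)
                + (2 * C1 * S1) * (2 * C2 * S2)).
Proof.
move=> h1 h2 /=; set C1 := c1 ^+ 2 - _; set S1 := 2 * c1 * _.
set C2 := c2 ^+ 2 - _; set S2 := 2 * c2 * _.
have dot2 : C1 * C2 + S1 * S2 = 2 * (c1 * c2 + s1 * s2) ^+ 2 - 1.
  exact: double_angle_dot.
rewrite (double_angle_dot (double_angle_unit h1) (double_angle_unit h2)) dot2.
have dot_le1 : (c1 * c2 + s1 * s2) ^+ 2 <= 1.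
  have -> : (1 : R) = (c1 ^+ 2 + s1 ^+ 2) * (c2 ^+ 2 + s2 ^+ 2).
    by rewrite h1 h2 mulr1.
  by have := sqr_ge0 (c1 * s2 - s1 * c2); nra.
move: dot_le1; rewrite -(real_normK (num_real (c1 * c2 + s1 * s2))).
set x := `|_|; have x_ge0 : 0 <= x by exact: normr_ge0.
rewrite expr_le1 // => x_le1.
have : 0 <= (1 - x) * (2 * x - 1) ^+ 2 * (x + 2).
  by apply: mulr_ge0; [rewrite mulr_ge0 ?sqr_ge0 // subr_ge0 | lra].
lra.
Qed.

(** At the origin every direction is allowed; (1, 0) is chosen. *)
Lemma polar_coordinates (R : rcfType) (u v : R) :
  exists w c s : R, [/\ 0 <= w, c ^+ 2 + s ^+ 2 = 1, u = w * c & v = w * s].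
Proof.
pose w := Num.sqrt (u ^+ 2 + v ^+ 2).
have w2 : w ^+ 2 = u ^+ 2 + v ^+ 2.
  by rewrite sqr_sqrtr // addr_ge0 ?sqr_ge0.
have [w0|w_neq0] := eqVneq w 0.
  exists 0, 1, 0; move: w2; rewrite w0 expr0n /= => /esym/eqP.
  rewrite paddr_eq0 ?sqr_ge0 // !sqrf_eq0 => /andP[/eqP-> /eqP->].
  by split; rewrite ?lexx ?expr1n ?addr0 ?mul0r.
exists w, (u / w), (v / w); split; first exact: sqrtr_ge0.
- by rewrite !expr_div_n -mulrDl -w2 divff // expf_neq0.
- by rewrite mulrC divfK.
- by rewrite mulrC divfK.
Qed.

(** * Rank two projections *)

Lemma sum_sqr_double (R : comNzRingType) (I : finType) (a : I -> R) :
  (\sum_i a i) ^+ 2 = \sum_i \sum_j a i * a j.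
Proof. by rewrite expr2 mulr_suml; apply: eq_bigr => i _; rewrite mulr_sumr. Qed.

Lemma sum_cauchy_schwarz (R : realFieldType) (I : finType) (a b : I -> R) :
  (\sum_i a i * b i) ^+ 2 <= (\sum_i a i ^+ 2) * (\sum_i b i ^+ 2).
Proof.
have lagrange : 0 <= \sum_i \sum_j (a i * b j - a j * b i) ^+ 2.
  by apply: sumr_ge0 => i _; apply: sumr_ge0 => j _; exact: sqr_ge0.
have normE : (\sum_i a i ^+ 2) * (\sum_i b i ^+ 2) =
             \sum_i \sum_j a i ^+ 2 * b j ^+ 2.
  by rewrite mulr_suml; apply: eq_bigr => i _; rewrite mulr_sumr.
have normE' : (\sum_i a i ^+ 2) * (\sum_i b i ^+ 2) =
              \sum_i \sum_j a j ^+ 2 * b i ^+ 2.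
  by rewrite normE exchange_big.
have expand : \sum_i \sum_j (a i * b j - a j * b i) ^+ 2 =
    \sum_i \sum_j a i ^+ 2 * b j ^+ 2 + \sum_i \sum_j a j ^+ 2 * b i ^+ 2
    - 2 * \sum_i \sum_j (a i * b i) * (a j * b j).
  rewrite mulr_sumr -sumrN -!big_split /=; apply: eq_bigr => i _.
  rewrite mulr_sumr -sumrN -!big_split /=; apply: eq_bigr => j _.
  ring.
rewrite sum_sqr_double.
move: lagrange; rewrite expand -normE -normE'; lra.
Qed.

(** The maximal l1 norm 4n/3 is attained, when 3 divides n, by spreading three
    equiangular lines of the plane evenly over the coordinates. *)
Lemma sum_abs_projection_le (R : rcfType) (n : nat) (u v : 'I_n -> R) :
    \sum_i u i ^+ 2 = 1 -> \sum_i v i ^+ 2 = 1 -> \sum_i u i * v i = 0 ->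
  \sum_i \sum_j `|u i * u j + v i * v j| <= 4 / 3 * n%:R.
Proof.
move=> uu vv uv.
have [w [c [s [w_ge0 cs1 uE vE]]]] : exists w c s : 'I_n -> R,
    [/\ forall i, 0 <= w i, forall i, c i ^+ 2 + s i ^+ 2 = 1,
        forall i, u i = w i * c i & forall i, v i = w i * s i].
  have [w /fin_all_exists[c /fin_all_exists[s P]]] :=
    fin_all_exists (fun i => polar_coordinates (u i) (v i)).
  by exists w, c, s; split=> i; case: (P i).
pose C i := c i ^+ 2 - s i ^+ 2; pose S i := 2 * c i * s i.
pose D i := C i ^+ 2 - S i ^+ 2; pose E i := 2 * C i * S i.
pose W := \sum_i w i.
have w2_sum : \sum_i w i ^+ 2 = 2.
  rewrite -[2]/(1 + 1) -{1}uu -vv -big_split /=; apply: eq_bigr => i _.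
  by rewrite uE vE -[LHS]mulr1 -(cs1 i); ring.
(* Both parts of sum_i w_i z_i = 0: its real part is |u|^2 - |v|^2 and its
   imaginary part is 2 <u, v>. *)
have wC0 : \sum_i w i * (w i * C i) = 0.
  apply: (@eq_trans _ _ (\sum_i u i ^+ 2 - \sum_i v i ^+ 2)).
    rewrite -sumrB; apply: eq_bigr => i _; rewrite uE vE /C; ring.
  by rewrite uu vv subrr.
have wS0 : \sum_i w i * (w i * S i) = 0.
  apply: (@eq_trans _ _ (2 * \sum_i u i * v i)).
    rewrite mulr_sumr; apply: eq_bigr => i _; rewrite uE vE /S; ring.
  by rewrite uv mulr0.
have W2_le : W ^+ 2 <= 2 * n%:R.
  have := sum_cauchy_schwarz w (fun=> 1).
  under eq_bigr do rewrite mulr1.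
  under [\sum_i 1 ^+ 2]eq_bigr do rewrite expr1n.
  by rewrite w2_sum sumr_const card_ord.
pose r i := 1 - W / 2 * w i.
have r2_sum : \sum_i r i ^+ 2 = n%:R - W ^+ 2 / 2.
  apply: (@eq_trans _ _
    (\sum_(i < n) 1 - W * \sum_i w i + W ^+ 2 / 4 * \sum_i w i ^+ 2)).
    rewrite !mulr_sumr -sumrN -!big_split /=; apply: eq_bigr => i _.
    by rewrite /r; field.
  by rewrite w2_sum sumr_const card_ord -/W; field.
have weight (z : 'I_n -> R) : \sum_i w i * (w i * z i) = 0 ->
    \sum_i w i * z i = \sum_i r i * (w i * z i).
  move=> wz0; apply: (@eq_trans _ _
    (\sum_i w i * z i - W / 2 * \sum_i w i * (w i * z i))).
    by rewrite wz0 mulr0 subr0.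
  rewrite mulr_sumr -sumrB; apply: eq_bigr => i _; rewrite /r; ring.
have z_sum_le : (\sum_i w i * C i) ^+ 2 + (\sum_i w i * S i) ^+ 2 <=
                2 * n%:R - W ^+ 2.
  have z2_sum : \sum_i (w i * C i) ^+ 2 + \sum_i (w i * S i) ^+ 2 = 2.
    rewrite -w2_sum -big_split /=; apply: eq_bigr => i _.
    rewrite -[RHS]mulr1 -(double_angle_unit (cs1 i)) -/(C i) -/(S i); ring.
  rewrite (weight _ wC0) (weight _ wS0).
  apply: (le_trans (lerD (sum_cauchy_schwarz r (fun i => w i * C i))
                         (sum_cauchy_schwarz r (fun i => w i * S i)))).
  rewrite -mulrDr z2_sum r2_sum; lra.
have pointwise i j : `|u i * u j + v i * v j| <=
    2 / 3 * (w i * w j)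
    + 7 / 18 * ((w i * C i) * (w j * C j) + (w i * S i) * (w j * S j))
    - 1 / 18 * ((w i * D i) * (w j * D j) + (w i * E i) * (w j * E j)).
  have -> : u i * u j + v i * v j = (w i * w j) * (c i * c j + s i * s j).
    by rewrite !uE !vE; ring.
  rewrite normrM (ger0_norm (mulr_ge0 _ _)) //.
  apply: le_trans (ler_wpM2l (mulr_ge0 (w_ge0 i) (w_ge0 j))
                     (abs_dot_le (cs1 i) (cs1 j))) _.
  rewrite le_eqVlt; apply/orP; left; apply/eqP; rewrite /E /D /C /S; ring.
apply: (@le_trans _ _ (2 / 3 * W ^+ 2
    + 7 / 18 * ((\sum_i w i * C i) ^+ 2 + (\sum_i w i * S i) ^+ 2)
    - 1 / 18 * ((\sum_i w i * D i) ^+ 2 + (\sum_i w i * E i) ^+ 2))).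
  rewrite !sum_sqr_double -!big_split !mulr_sumr -sumrN -!big_split /=.
  apply: ler_sum => i _.
  rewrite -!big_split !mulr_sumr -sumrN -!big_split /=.
  by apply: ler_sum => j _; exact: pointwise.
have := sqr_ge0 (\sum_i w i * D i); have := sqr_ge0 (\sum_i w i * E i).
lra.
Qed.

(** * Coherence of more than d + 1 vectors of R^d *)

Lemma unit_kernel_vector (R : rcfType) (m n : nat) (A : 'M[R]_(m, n)) :
    (n < m)%N ->
  exists2 u : 'rV[R]_m, u *m A = 0 & \sum_i u 0 i ^+ 2 = 1.
Proof.
move=> ltnm.
have /rowV0Pn[x /sub_kermxP xA x_neq0] : kermx A != 0.
  by rewrite kermx_eq0 /row_free neq_ltn (leq_ltn_trans (rank_leq_col A)).
pose N := \sum_i x 0 i ^+ 2.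
have N_gt0 : 0 < N.
  rewrite lt_def sumr_ge0 ?andbT => [|i _]; last exact: sqr_ge0.
  apply: contraNneq x_neq0 => /psumr_eq0P N0.
  apply/eqP/rowP => i; rewrite mxE; apply/eqP.
  by rewrite -sqrf_eq0 N0 // => j _; exact: sqr_ge0.
exists ((Num.sqrt N)^-1 *: x); first by rewrite -scalemxAl xA scaler0.
under eq_bigr do rewrite mxE exprMn exprVn sqr_sqrtr ?ltW //.
by rewrite -mulr_sumr mulVf // gt_eqF.
Qed.

Lemma inner_gram (R : realType) (d n : nat) (Psi : 'M[R]_(d, n)) (i j : 'I_n) :
  inner (col i Psi) (col j Psi) = (Psi^T *m Psi) i j.
Proof. by rewrite !mxE; apply: eq_bigr => k _; rewrite !mxE. Qed.

Lemma packing_gram_diag (R : realType) (d n : nat) (Psi : 'M[R]_(d, n)) :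
  is_packing Psi -> forall i, (Psi^T *m Psi) i i = 1.
Proof.
move=> Psi1 i; rewrite -inner_gram; set x := inner _ _.
have x_ge0 : 0 <= x.
  by apply: sumr_ge0 => k _; rewrite -expr2 sqr_ge0.
by rewrite -(sqr_sqrtr x_ge0) Psi1 expr1n.
Qed.

(** Pairing the Gram matrix with the projection onto two orthonormal
    vectors of its kernel gives 0 = 2 + (off-diagonal terms), and the latter are at
    least - coherence * (4n/3 - 2) by [sum_abs_projection_le]. *)
Lemma coherence_lower_bound (R : realType) (d n : nat) (Psi : 'M[R]_(d, n)) :
    (d.+1 < n)%N -> is_packing Psi ->
  3 <= coherence Psi * (2 * n%:R - 3).
Proof.
move=> lt_dn Psi1; pose G := Psi^T *m Psi; pose m := coherence Psi.
have lt_dn' : (d < n)%N by exact: ltnW.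
have [u uPsi uu] := unit_kernel_vector Psi^T lt_dn'.
(* v is the second step of a Gram-Schmidt process: the extra column forces it
   to be orthogonal to u. *)
have lt_dn1 : (d + 1 < n)%N by rewrite addn1.
have [v vA vv] := unit_kernel_vector (row_mx Psi^T u^T) lt_dn1.
move: vA; rewrite mul_mx_row -[0](@row_mx0 _ 1 d 1) => /eq_row_mx[vPsi vu].
have uv : \sum_i u 0 i * v 0 i = 0.
  have := congr1 (fun M : 'M_1 => M 0 0) vu; rewrite !mxE.
  by apply: eq_trans; apply: eq_bigr => i _; rewrite mxE mulrC.
pose P i j := u 0 i * u 0 j + v 0 i * v 0 j.
have form0 (x : 'rV_n) : x *m Psi^T = 0 ->
    \sum_i \sum_j G i j * (x 0 i * x 0 j) = 0.
  move=> xPsi; rewrite exchange_big /=; apply: big1 => j _.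
  have := congr1 (fun y : 'rV_n => y 0 j * x 0 j) (mulmxA x Psi^T Psi).
  rewrite /= xPsi mul0mx [in RHS]mxE mul0r mxE mulr_suml.
  by apply: eq_trans; apply: eq_bigr => i _; rewrite -/G; ring.
have trace0 : \sum_i \sum_j G i j * P i j = 0.
  have := congr2 +%R (form0 u uPsi) (form0 v vPsi).
  rewrite addr0; apply: eq_trans; rewrite -big_split /=.
  apply: eq_bigr => i _; rewrite -big_split /=.
  by apply: eq_bigr => j _; rewrite -mulrDr.
have trace2 : \sum_i P i i = 2.
  by rewrite big_split -[2]/(1 + 1) -{1}uu -vv.
(* Diagonal terms enter as P i i, off-diagonal ones as - m * |P i j|. *)
have row_ge i : (1 + m) * P i i - m * \sum_j `|P i j| <= \sum_j G i j * P i j.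
  have Pii : `|P i i| = P i i.
    by rewrite ger0_norm // addr_ge0 // -expr2 sqr_ge0.
  rewrite (bigD1 i) //= [leRHS](bigD1 i) //= Pii packing_gram_diag //.
  have : \sum_(j | j != i) - (m * `|P i j|) <= \sum_(j | j != i) G i j * P i j.
    apply: ler_sum => j neq_ji; rewrite lerNl -mulNr.
    apply: le_trans (ler_norm _) _; rewrite normrM normrN ler_wpM2r //.
    rewrite /G -inner_gram.
    apply: (le_bigmax_cond 0 (fun p : 'I_n * 'I_n =>
      `|inner (col p.1 Psi) (col p.2 Psi)|) (j := (i, j))).
    by rewrite /= eq_sym.
  rewrite sumrN -mulr_sumr; lra.
have m_ge0 : 0 <= m by exact: bigmax_ge_id.
have sum_ge : (1 + m) * 2 - m * \sum_i \sum_j `|P i j| <= 0.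
  have : \sum_i ((1 + m) * P i i - m * \sum_j `|P i j|) <=
         \sum_i \sum_j G i j * P i j by apply: ler_sum.
  by rewrite trace0 sumrB -!mulr_sumr trace2.
have := ler_wpM2l m_ge0
  (sum_abs_projection_le uu vv uv).
rewrite -/m; lra.
Qed.

Theorem theorem7 (R : realType) (Phi : 'M[R]_(4, 6))
    (Phi_packing : is_packing Phi)
    (Phi_gram : Phi^T *m Phi = gram6 (1 / 3 : R)) :
  is_optimal_packing Phi.
Proof.
split=> // Psi Psi_packing.
have third_le : 1 / 3 <= coherence Psi.
  have := coherence_lower_bound (isT : (5 < 6)%N) Psi_packing; lra.
apply: le_trans third_le; apply: bigmax_le => [|[i j] /= neq_ij]; first by lra.
rewrite inner_gram Phi_gram mxE.
have norm_third : `|1 / 3 : R| <= 1 / 3 by rewrite ger0_norm //; lra.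
by case: i j neq_ij => [[|[|[|[|[|[|//]]]]]] ?] [[|[|[|[|[|[|//]]]]]] ?] //= _;
  rewrite ?normrN.
Qed.
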